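(* Let $\mathcal T=\{T_1,\dots,T_m\}\subset\mathbb C^{d\times d}$ be a family of matrices that are all upper triangular or all lower triangular, with nonzero diagonal entries $(T_i)_{jj}=\lambda_j^{(i)}$, and with probability weights $p_1,\dots,p_m$. Define $$\Lambda(\boldsymbol t):=\log\sum_{i=1}^m p_i\exp\Bigl(\sum_{j=1}^d t_j\log|\lambda_j^{(i)}|\Bigr),\quad\boldsymbol t\in\mathbb R^d,\qquad I(\boldsymbol z):=\sup_{\boldsymbol t\in\mathbb R^d}\bigl(\boldsymbol t\cdot\boldsymbol z-\Lambda(\boldsymbol t)\bigr),\quad \boldsymbol z\in\mathbb R^d.$$ Then $\rho_n$ satisfies a large deviation principle on $(0,\infty)$ with speed $n$ and good rate function $$\widetilde I(r):=\inf\Bigl\{I(\boldsymbol z):\ \boldsymbol z\in\mathbb R^d,\ \max_{1\le j\le d}z_j=\log r\Bigr\},\qquad r>0.$$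
   Context: $\mathbb P_{\mathcal T}$ assigns mass $p_i\ge 0$ to $T_i$, with $\sum_i p_i=1$. Let $(i_k)_{k\ge1}$ be i.i.d. random indices in $\{1,\dots,m\}$ with $\mathbb P(i_k=i)=p_i$. The random spectral radius of length $n$ is $\rho_n:=\rho(T_{i_n}\cdots T_{i_1})^{1/n}$, where $\rho(\cdot)$ is the spectral radius. A large deviation principle with speed $n$ and good rate function $\widetilde I$ means: $\widetilde I:(0,\infty)\to[0,\infty]$ is lower semicontinuous with compact sublevel sets and, for every Borel $B\subseteq(0,\infty)$, $-\inf_{B^\circ}\widetilde I\le\liminf_n\frac1n\log\mathbb P(\rho_n\in B)\le\limsup_n\frac1n\log\mathbb P(\rho_n\in B)\le-\inf_{\overline B}\widetilde I$, with interior and closure taken in $(0,\infty)$. *)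

(* Defs.v *)
From HB Require Import structures.
From mathcomp Require Import all_boot all_order all_algebra.
From mathcomp Require Import complex.
From mathcomp Require Import all_classical all_reals all_analysis.

Set Implicit Arguments.
Unset Strict Implicit.
Unset Printing Implicit Defensive.

Import Order.TTheory GRing.Theory Num.Theory.
Import numFieldNormedType.Exports.

Local Open Scope classical_set_scope.
Local Open Scope ring_scope.

Definition cmod (R : realType) (z : R[i]) : R := ComplexField.Normc.normc z.

(* For [0 < d] the set of moduli is finite and nonempty, so [sup] is a maximum;
   [eigenvalue] uses row eigenvectors, which gives the same spectrum. *)
Definition spectral_radius (R : realType) (d : nat) (A : 'M[R[i]]_d) : R :=
  sup [set cmod a | a in [set a | eigenvalue A a]].

(* [matprod T w n = T (w n.-1) *m ... *m T (w 0)]: time is indexed from 0, so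
   [w k] plays the role of the index $i_{k+1}$. *)
Fixpoint matprod (R : realType) (m d : nat) (T : 'I_m -> 'M[R[i]]_d)
    (w : nat -> 'I_m) (n : nat) : 'M[R[i]]_d :=
  if n is n'.+1 then T (w n') *m matprod T w n' else 1%:M.

Definition rho_n (R : realType) (m d : nat) (T : 'I_m -> 'M[R[i]]_d)
    (w : nat -> 'I_m) (n : nat) : R :=
  spectral_radius (matprod T w n) `^ n%:R^-1.

(* The finite set ['I_m] carries its discrete sigma-algebra, hence the
   quantification over all subsets of ['I_m]. *)
Definition iid_indices (disp : measure_display) (Omega : measurableType disp)
    (R : realType) (P : probability Omega R) (m : nat) (p : 'I_m -> R)
    (i : nat -> Omega -> 'I_m) : Prop :=
  [/\ forall k (A : set 'I_m), measurable (i k @^-1` A),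
      forall J : seq nat, uniq J -> forall A : nat -> set 'I_m,
        P (\bigcap_(k in [set` J]) (i k @^-1` A k)) =
        (\prod_(k <- J) P (i k @^-1` A k))%E
    & forall k a, P (i k @^-1` [set a]) = (p a)%:E].

(* All topological notions are those of [subspace E], the type [R] with the
   topology in which the points of [E] have the trace neighbourhoods and the
   other points are isolated.  For subsets of [E], interior, closure and
   compactness are thus the ones relative to [E], and semicontinuity only
   constrains [I] on [E]. *)
Definition good_rate_function (R : realType) (E : set R) (I : R -> \bar R) :
    Prop :=
  [/\ forall x, E x -> (0 <= I x)%E,
      lower_semicontinuous (I : subspace E -> \bar R)
    & forall a : R,
        compact (E `&` [set x | (I x <= a%:E)%E] : set (subspace E))].

(* Large deviation principle on [E] with speed [n] for the laws of [X n]; the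
   conventions are [lne 0 = -oo] and [ereal_inf set0 = +oo]. *)
Definition LDP (disp : measure_display) (Omega : measurableType disp)
    (R : realType) (P : probability Omega R) (E : set R)
    (X : nat -> Omega -> R) (I : R -> \bar R) : Prop :=
  good_rate_function E I /\
  forall B : set R, measurable B -> B `<=` E ->
    [/\ (- ereal_inf (I @` interior (B : set (subspace E))) <=
         limn_einf (fun n => (n%:R^-1)%:E * lne (P (X n @^-1` B))))%E,
        (limn_einf (fun n => (n%:R^-1)%:E * lne (P (X n @^-1` B))) <=
         limn_esup (fun n => (n%:R^-1)%:E * lne (P (X n @^-1` B))))%E
      & (limn_esup (fun n => (n%:R^-1)%:E * lne (P (X n @^-1` B))) <=
         - ereal_inf (I @` closure (B : set (subspace E))))%E].

Definition dotp (R : realType) (d : nat) (t z : 'rV[R]_d) : R :=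
  \sum_(j < d) t 0 j * z 0 j.

Definition Lambda (R : realType) (m d : nat) (p : 'I_m -> R)
    (T : 'I_m -> 'M[R[i]]_d) (t : 'rV[R]_d) : R :=
  ln (\sum_(i < m) p i *
        expR (\sum_(j < d) t 0 j * ln (cmod (T i j j)))).

Definition rate (R : realType) (m d : nat) (p : 'I_m -> R)
    (T : 'I_m -> 'M[R[i]]_d) (z : 'rV[R]_d) : \bar R :=
  ereal_sup [set (dotp t z - Lambda p T t)%:E | t in [set: 'rV[R]_d]].

(* The maximum is taken in the extended reals because [-oo] is the neutral
   element of [maxe]; it is finite as soon as [0 < d]. *)
Definition contracted_rate (R : realType) (m d : nat) (p : 'I_m -> R)
    (T : 'I_m -> 'M[R[i]]_d) (r : R) : \bar R :=
  ereal_inf [set rate p T z |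
    z in [set z : 'rV[R]_d | \big[maxe/-oo%E]_(j < d) (z 0 j)%:E = (ln r)%:E]].

(* Main.v *)
(* For triangular matrices the spectrum of a product is read off the diagonal, so
   [log rho_n] is the largest coordinate of the empirical mean of the i.i.d.
   vectors [(log |lambda_j^(i_k)|)_j]: the principle is Cramer's theorem in R^d
   contracted along [max].  The vectors take finitely many values, so every
   probability is a finite sum over words.  Upper bound: the means lie in a
   compact box, whose part above the closed set is covered by finitely many
   half-spaces, each estimated by Chernoff's bound.  Lower bound: exponential
   tilting and the weak law; a point [z] of finite rate is first approximated by
   means of tilted laws of almost the same rate, through almost maximisers of
   the Legendre functional with a small quadratic penalty. *)

Require Import Defs.
From HB Require Import structures.
From mathcomp Require Import all_boot all_order all_algebra.
From mathcomp Require Import complex.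
From mathcomp Require Import all_classical all_reals all_analysis.
From mathcomp Require Import ring lra.

Set Implicit Arguments.
Unset Strict Implicit.
Unset Printing Implicit Defensive.

Import Order.TTheory GRing.Theory Num.Theory.
Import numFieldNormedType.Exports.

Local Open Scope classical_set_scope.
Local Open Scope ring_scope.

(** * Weighted words of length n *)

(** From [1 - u <= expR (- u)] one gets [expR u <= (1 - u)^-1], and [(1 + u + 2 u^2) (1 - u) - 1 =
    u^2 (1 - 2 u)] is nonnegative. *)
Lemma expR_le_quad (R : realType) (u : R) :
  u <= 2^-1 -> expR u <= 1 + u + 2 * u ^+ 2.
Proof.
move=> u_le.
have lin : 1 - u <= expR (- u) by have := expR_ge1Dx (- u).
have lin_gt0 : 0 < 1 - u by lra.
rewrite -[expR u]invrK -expRN.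
apply: (@le_trans _ _ (1 - u)^-1).
  by rewrite lef_pV2 ?posrE ?expR_gt0.
rewrite -[leLHS]mul1r ler_pdivrMr //.
have : 0 <= u ^+ 2 * (1 - 2 * u) by rewrite mulr_ge0 ?sqr_ge0 //; lra.
rewrite -subr_ge0 => h; rewrite -subr_ge0.
suff -> : (1 + u + 2 * u ^+ 2) * (1 - u) - 1 = u ^+ 2 * (1 - 2 * u) - 0 by [].
by ring.
Qed.

(** Here [p] is any weight function, because [chernoff] also evaluates it at exponentially
    reweighted weights, whose total mass is in general not one. *)
Definition wprob (R : realType) (m : nat) (p : 'I_m -> R) (n : nat)
    (A : set {ffun 'I_n -> 'I_m}) : R :=
  \sum_(w | w \in A) \prod_(k < n) p (w k).

Section WordProbability.
Variables (R : realType) (m : nat).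
Implicit Types (p q y : 'I_m -> R) (n : nat).

Lemma wprob_ge0 p n (A : set {ffun 'I_n -> 'I_m}) :
  (forall i, 0 <= p i) -> 0 <= wprob p A.
Proof. by move=> p0; apply: sumr_ge0 => w _; apply: prodr_ge0. Qed.

Lemma le_wprob p n (A B : set {ffun 'I_n -> 'I_m}) :
  (forall i, 0 <= p i) -> A `<=` B -> wprob p A <= wprob p B.
Proof.
move=> p0 AB; rewrite /wprob [leRHS](bigID (fun w => w \in A)) /=.
rewrite -[leLHS]addr0 lerD //.
  rewrite [leRHS](eq_bigl (fun w => w \in A)) // => w /=.
  by rewrite andb_idl // => /set_mem /AB /mem_set.
by apply: sumr_ge0 => w _; apply: prodr_ge0.
Qed.

Lemma wprobT p n : wprob p [set: {ffun 'I_n -> 'I_m}] = (\sum_i p i) ^+ n.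
Proof.
rewrite /wprob (eq_bigl xpredT) => [|w]; last by rewrite in_setT.
by rewrite -(bigA_distr_bigA (fun _ => p)) prodr_const card_ord.
Qed.

Lemma wprobC p n (A : set {ffun 'I_n -> 'I_m}) :
  \sum_i p i = 1 -> wprob p A = 1 - wprob p (~` A).
Proof.
move=> p1; apply/eqP; rewrite eq_sym subr_eq; apply/eqP.
rewrite -(expr1n R n) -p1 -wprobT /wprob.
rewrite (bigID (fun w => w \in A)) /=; congr (_ + _); apply: eq_bigl => w.
  by rewrite in_setT.
by rewrite in_setT in_setC.
Qed.

Lemma wprob_bigcup p n (I : Type) (r : seq I)
    (A : set {ffun 'I_n -> 'I_m}) (F : I -> set {ffun 'I_n -> 'I_m}) :
  (forall i, 0 <= p i) -> (forall w, A w -> has (fun i => w \in F i) r) ->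
  wprob p A <= \sum_(i <- r) wprob p (F i).
Proof.
move=> p0 AF; rewrite /wprob.
under [leRHS]eq_bigr do rewrite big_mkcond.
rewrite exchange_big /= big_mkcond /=; apply: ler_sum => w _.
have pw0 : 0 <= \prod_(k < n) p (w k) by apply: prodr_ge0.
case: ifPn => [|_]; last by apply: sumr_ge0 => i _; case: ifP.
rewrite inE => /AF; elim: r {AF} => //= i r IH.
rewrite big_cons; case: ifPn => _ /= H.
  by rewrite lerDl; apply: sumr_ge0 => j _; case: ifP.
by rewrite add0r IH.
Qed.

(** On the event, the product of the factors [expR (y (w k) - a)] is at least 1. Inserting it bounds
    the mass by that of all words under the reweighted [p], which factorises. *)
Lemma chernoff p y (a : R) n : (forall i, 0 <= p i) ->
  wprob p [set w : {ffun 'I_n -> 'I_m} | n%:R * a <= \sum_(k < n) y (w k)] <=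
  (\sum_i p i * expR (y i - a)) ^+ n.
Proof.
move=> p0; rewrite -wprobT /wprob big_mkcond [leRHS]big_mkcond /=.
apply: ler_sum => w _; rewrite in_setT big_split /= -expR_sum.
have pw0 : 0 <= \prod_(k < n) p (w k) by apply: prodr_ge0.
case: ifPn => [|_]; last by rewrite mulr_ge0 ?expR_ge0.
rewrite inE /= => le_w; rewrite -[leLHS]mulr1 ler_wpM2l //.
rewrite -expR0 ler_expR sumrB sumr_const card_ord -mulr_natl.
by rewrite subr_ge0.
Qed.

(* Chernoff's bound at a small slope [s] already decays exponentially. *)
Lemma weak_law p y (delta eps : R) : (forall i, 0 <= p i) ->
  \sum_i p i = 1 -> \sum_i p i * y i = 0 -> 0 < delta -> 0 < eps ->
  \forall n \near \oo, wprob p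
    [set w : {ffun 'I_n -> 'I_m} | n%:R * delta <= \sum_(k < n) y (w k)] <= eps.
Proof.
move=> p0 p1 py0 d0 eps0.
pose D := \sum_i p i * (y i - delta) ^+ 2.
have D0 : 0 <= D by apply: sumr_ge0 => i _; rewrite mulr_ge0 ?sqr_ge0.
pose M := \sum_i `|y i - delta|.
have M0 : 0 <= M by apply: sumr_ge0.
have leM i : y i - delta <= M.
  apply: (le_trans (ler_norm _)).
  by rewrite /M (bigD1 i) //= lerDl sumr_ge0.
(* The first bound keeps [s * (y i - delta)] below 1/2, as [expR_le_quad] demands; the second gives
   [2 s^2 D <= s delta / 2], so that [kappa <= 1 - s delta / 2]. *)
pose s := Num.min (2 * (1 + M))^-1 (delta / (4 * (1 + D))).
have s0 : 0 < s.
  by rewrite /s lt_min invr_gt0 divr_gt0 ?andbT //; lra.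
have sM i : s * (y i - delta) <= 2^-1.
  apply: (@le_trans _ _ (s * M)); first by rewrite ler_wpM2l // ltW.
  apply: (@le_trans _ _ ((2 * (1 + M))^-1 * M)).
    by rewrite ler_wpM2r // /s ge_min lexx.
  rewrite mulrC ler_pdivrMr; lra.
have sD : 4 * (s * D) <= delta.
  have : s <= delta / (4 * (1 + D)) by rewrite /s ge_min lexx orbT.
  rewrite ler_pdivlMr; nra.
pose kappa := \sum_i p i * expR (s * y i - s * delta).
have kappa0 : 0 <= kappa by apply: sumr_ge0 => i _; rewrite mulr_ge0 ?expR_ge0.
have kappa1 : kappa < 1.
  apply: (@le_lt_trans _ _ (\sum_i p i *
      (1 + s * (y i - delta) + 2 * (s * (y i - delta)) ^+ 2))).
    by apply: ler_sum => i _; rewrite ler_wpM2l // -mulrBr expR_le_quad.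
  rewrite (_ : \sum_i _ = 1 - s * delta + 2 * s ^+ 2 * D); last first.
    have -> : 1 - s * delta + 2 * s ^+ 2 * D =
        \sum_i p i + (s * \sum_i p i * y i - s * delta * \sum_i p i) +
        2 * s ^+ 2 * D by rewrite p1 py0; ring.
    rewrite /D !mulr_sumr -sumrB -!big_split /=.
    by apply: eq_bigr => i _; ring.
  nra.
have : \forall n \near \oo, kappa ^+ n <= eps.
  have /cvgr0_norm_le : (fun n => kappa ^+ n) @ \oo --> 0.
    by apply: cvg_expr; rewrite ger0_norm.
  move=> /(_ _ eps0); apply: filterS => n; apply: le_trans; exact: ler_norm.
apply: filterS => n; apply: le_trans.
apply: (le_trans _ (chernoff (fun i => s * y i) (s * delta) n p0)).
apply: le_wprob => // w /= le_w.
by rewrite -mulr_sumr mulrCA ler_wpM2l // ltW.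
Qed.

End WordProbability.

(** * Cumulants and exponential tilting *)

Section Cumulant.
Variables (R : realType) (m d : nat).
Implicit Types (p q : 'I_m -> R) (x : 'I_m -> 'rV[R]_d) (t z h : 'rV[R]_d).

Lemma dotpDl t h z : dotp (t + h) z = dotp t z + dotp h z.
Proof. by rewrite -big_split; apply: eq_bigr => j _; rewrite mxE mulrDl. Qed.

Lemma dotpC t z : dotp t z = dotp z t.
Proof. by apply: eq_bigr => j _; rewrite mulrC. Qed.

Lemma dotpZl s t z : dotp (s *: t) z = s * dotp t z.
Proof. by rewrite mulr_sumr; apply: eq_bigr => j _; rewrite mxE mulrA. Qed.

Lemma dotp0l z : dotp 0 z = 0.
Proof. by rewrite -(scale0r (0 : 'rV[R]_d)) dotpZl mul0r. Qed.

Lemma dotp_delta j z : dotp (delta_mx 0 j) z = z 0 j.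
Proof.
rewrite /dotp (bigD1 j) //= big1 => [|k kj]; rewrite mxE eqxx /=.
  by rewrite eqxx mul1r addr0.
by rewrite (negPf kj) mul0r.
Qed.

Lemma dotp_ge0 t : 0 <= dotp t t.
Proof. by apply: sumr_ge0 => j _; rewrite -expr2 sqr_ge0. Qed.

Lemma dotp_coord t j : t 0 j ^+ 2 <= dotp t t.
Proof.
rewrite /dotp (bigD1 j) //= expr2 lerDl.
by apply: sumr_ge0 => k _; rewrite -expr2 sqr_ge0.
Qed.

Definition cumulant p x t : R := ln (\sum_i p i * expR (dotp t (x i))).

(** Subtracting [cumulant] in the exponent normalises the law; its mean plays the role of the
    gradient of [cumulant] at [t]. *)
Definition tilt p x t (i : 'I_m) : R :=
  p i * expR (dotp t (x i) - cumulant p x t).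

Definition mean q x : 'rV[R]_d := \sum_i q i *: x i.

Lemma meanE q x j : mean q x 0 j = \sum_i q i * x i 0 j.
Proof. by rewrite summxE; apply: eq_bigr => i _; rewrite mxE. Qed.

Lemma dotp_mean q x t : dotp t (mean q x) = \sum_i q i * dotp t (x i).
Proof.
rewrite /dotp; under eq_bigr do rewrite meanE mulr_sumr.
rewrite exchange_big; apply: eq_bigr => i _; rewrite mulr_sumr.
by apply: eq_bigr => j _; rewrite mulrCA.
Qed.

Lemma sum_mul_expR_gt0 p (y : 'I_m -> R) :
  (forall i, 0 <= p i) -> \sum_i p i = 1 -> 0 < \sum_i p i * expR (y i).
Proof.
move=> p_ge0 p_sum.
have F i : 0 <= p i * expR (y i) by rewrite mulr_ge0 ?expR_ge0.
rewrite lt_def sumr_ge0 // andbT; apply/eqP => /eqP.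
rewrite psumr_eq0 // => /allP all0.
have : \sum_i p i = 0.
  apply: big1 => i _; have /= := all0 i (mem_index_enum i).
  by rewrite mulf_eq0 [X in _ || X]gt_eqF ?expR_gt0 // orbF => /eqP.
by rewrite p_sum => /eqP; rewrite oner_eq0.
Qed.

Section Tilt.
Variables (p : 'I_m -> R) (x : 'I_m -> 'rV[R]_d).
Hypothesis p_ge0 : forall i, 0 <= p i.
Hypothesis p_sum : \sum_i p i = 1.

Lemma expR_cumulant t :
  expR (cumulant p x t) = \sum_i p i * expR (dotp t (x i)).
Proof. by rewrite lnK ?posrE ?sum_mul_expR_gt0. Qed.

Lemma cumulant0 : cumulant p x 0 = 0.
Proof.
rewrite /cumulant (eq_bigr p) ?p_sum ?ln1 // => i _.
by rewrite dotp0l expR0 mulr1.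
Qed.

Lemma tilt_ge0 t i : 0 <= tilt p x t i.
Proof. by rewrite mulr_ge0 ?expR_ge0. Qed.

Lemma tilt_sum t : \sum_i tilt p x t i = 1.
Proof.
rewrite /tilt; under eq_bigr do rewrite expRD mulrA.
by rewrite -mulr_suml -expR_cumulant -expRD subrr expR0.
Qed.

(** The increment is the logarithm of the tilted expectation of [expR (dotp h (x i))]; then
    [ln y <= y - 1] and [expR_le_quad] apply. This bound stands in for a Taylor expansion of
    [cumulant]. *)
Lemma cumulantD t h : (forall i, dotp h (x i) <= 2^-1) ->
  cumulant p x (t + h) <= cumulant p x t + dotp h (mean (tilt p x t) x) +
    2 * \sum_i tilt p x t i * dotp h (x i) ^+ 2.
Proof.
move=> h_le.
have -> : cumulant p x (t + h) = cumulant p x t +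
    ln (\sum_i tilt p x t i * expR (dotp h (x i))).
  rewrite -[X in _ = X + _]expRK -lnM ?posrE ?expR_gt0 //; last first.
    rewrite [ltRHS](eq_bigr (fun i =>
      p i * expR (dotp t (x i) - cumulant p x t + dotp h (x i)))) => [|i _].
      exact: sum_mul_expR_gt0.
    by rewrite [in RHS]expRD mulrA.
  rewrite [LHS]/cumulant mulr_sumr; congr ln; apply: eq_bigr => i _.
  rewrite /tilt -mulrA mulrCA -!expRD dotpDl; congr (_ * expR _).
  by ring.
rewrite -addrA lerD2l.
apply: (@le_trans _ _ (\sum_i tilt p x t i * expR (dotp h (x i)) - 1)).
  rewrite -[X in ln X](subrK 1) addrC le_ln1Dx // ltrBrDl subrr.
  exact: (sum_mul_expR_gt0 _ (tilt_ge0 t) (tilt_sum t)).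
rewrite lerBlDl -[X in X + _](tilt_sum t) dotp_mean mulr_sumr -!big_split /=.
apply: ler_sum => i _.
set q := tilt p x t i; set u := dotp h (x i).
have -> : q + (q * u + 2 * (q * u ^+ 2)) = q * (1 + u + 2 * u ^+ 2) by ring.
by rewrite ler_wpM2l ?tilt_ge0 ?expR_le_quad ?h_le.
Qed.

End Tilt.
End Cumulant.

(** * Lower bound in Cramer's theorem *)

Section LowerBound.
Variables (R : realType) (m d : nat).
Variables (p : 'I_m -> R) (x : 'I_m -> 'rV[R]_d).
Hypothesis p_ge0 : forall i, 0 <= p i.
Hypothesis p_sum : \sum_i p i = 1.

Lemma exists_coord_bound : exists2 M : R, 1 <= M & forall i j, `|x i 0 j| <= M.
Proof.
exists (1 + \sum_i \sum_j `|x i 0 j|).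
  by rewrite lerDl; do 2 apply: sumr_ge0 => ? _.
move=> i j; rewrite (bigD1 i) //= (bigD1 j) //=.
set a := \sum_(_ < _ | _) _; set b := \sum_(_ < _ | _) _.
have a0 : 0 <= a by apply: sumr_ge0.
have b0 : 0 <= b by do 2 apply: sumr_ge0 => ? _.
lra.
Qed.

(* When the supremum defining the rate at [z] is not attained, an almost
   maximiser of [t.z - Lambda t - eps/2 |t|^2] still yields a tilted law with
   mean near [z]: almost criticality gives [z - mean = eps t + o(1)] with
   [eps |t|^2] bounded. *)
Lemma exists_tilt (z : 'rV[R]_d) (v delta : R) :
  (forall t, dotp t z - cumulant p x t <= v) -> 0 < delta ->
  exists t, (forall j, `|z 0 j - mean (tilt p x t) x 0 j| < delta) /\
    dotp t (mean (tilt p x t) x) - cumulant p x t < v + delta.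
Proof.
move=> z_le d0.
have v0 : 0 <= v by have := z_le 0; rewrite dotp0l cumulant0 // subrr.
have [M M1 xM] := exists_coord_bound.
pose C := 2 + 2 * M ^+ 2.
have C2 : 2 <= C by rewrite lerDl mulr_ge0 ?sqr_ge0.
(* Once [eps |t|^2 <= 2 (v + 1)] is known, this yields [(eps t_j)^2 <= 2 eps (v + 1) <= delta^2 /
   4]. *)
pose eps := Num.min 1 (delta ^+ 2 / (8 * (v + 1))).
have eps0 : 0 < eps.
  by rewrite /eps lt_min ltr01 divr_gt0 ?exprn_gt0 //; lra.
have eps1 : eps <= 1 by rewrite /eps ge_min lexx.
have epsd : eps * (8 * (v + 1)) <= delta ^+ 2.
  rewrite -ler_pdivlMr; last lra.
  by rewrite /eps ge_min lexx orbT.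
pose D : R := d.+1%:R.
have D1 : 1 <= D by rewrite ler1n.
(* [s] is the length of a test step along a coordinate axis. The three bounds serve, in order, the
   hypothesis of [cumulantD], the estimate [s C <= delta / 4] of the gradient, and
   [d (s C)^2 / (4 eps) < delta] at the end. *)
pose s := Num.min (2 * M)^-1
  (Num.min (delta / (4 * C)) (delta * eps / (C ^+ 2 * D))).
have CD0 : 0 < C ^+ 2 * D by rewrite mulr_gt0 ?exprn_gt0 //; lra.
have s0 : 0 < s.
  rewrite /s !lt_min invr_gt0 !divr_gt0 ?mulr_gt0 //; lra.
have sM : s * M <= 2^-1.
  have : s <= (2 * M)^-1 by rewrite /s ge_min lexx.
  rewrite -[leRHS]mul1r ler_pdivlMr; lra.
have s1 : s <= 2^-1 by apply: le_trans sM; rewrite ler_peMr // ltW.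
have sC : s * C <= delta / 4.
  have : s <= delta / (4 * C) by rewrite /s !ge_min lexx orbT.
  rewrite ler_pdivlMr; lra.
have sCD : s * (C ^+ 2 * D) <= delta * eps.
  rewrite -ler_pdivlMr //.
  by rewrite /s !ge_min lexx !orbT.
pose phi t := dotp t z - cumulant p x t - eps / 2 * dotp t t.
have phi_le t : phi t <= v.
  have := z_le t; have := dotp_ge0 t; rewrite /phi; nra.
have has_sup_phi : has_sup (range phi).
  by split; [exists (phi 0); exists 0 | exists v => _ [t _ <-]].
have s20 : 0 < s ^+ 2 by rewrite exprn_gt0.
(* The defect [s^2] has the order of the quadratic terms of a step of length [s]; division by [s]
   leaves an error of order [s]. *)
have [_ [t _ <-] t_max] := sup_adherent s20 has_sup_phi.
have {t_max}phi_max h : phi (t + h) <= phi t + s ^+ 2.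
  rewrite -lerBlDr; apply: le_trans (ltW t_max).
  rewrite lerB //; apply: ub_le_sup (proj2 has_sup_phi) _ _.
  by exists (t + h).
exists t; set q := tilt p x t; set mu := mean q x.
have q_ge0 i : 0 <= q i by apply: tilt_ge0.
have q_sum : \sum_i q i = 1 by apply: tilt_sum.
(* The step [- t] compares [phi t] with [phi 0 = 0]. *)
have t_bnd : eps * dotp t t <= 2 * (v + 1).
  have := phi_max (- t); have := z_le t.
  rewrite subrr /phi !dotp0l cumulant0 // => h1 h2.
  have : s ^+ 2 <= 1 by nra.
  by move: h1 h2; lra.
(* [g] is the gradient of [phi] at [t]; almost maximality makes it small. *)
pose g j := z 0 j - mu 0 j - eps * t 0 j.
(* Both [r = s] and [r = - s] are used. [C = 2 + 2 M^2] collects the defect, the penalty and the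
   quadratic term of [cumulantD]. *)
have g_le j (r : R) : r ^+ 2 = s ^+ 2 -> r * g j <= s ^+ 2 * C.
  move=> r2; have := phi_max (r *: delta_mx 0 j); rewrite /phi.
  have rs : `|r| = s by rewrite -sqrtr_sqr r2 sqrtr_sqr gtr0_norm.
  have dx i : dotp (r *: delta_mx 0 j) (x i) = r * x i 0 j.
    by rewrite dotpZl dotp_delta.
  have h_le i : dotp (r *: delta_mx 0 j) (x i) <= 2^-1.
    rewrite dx (le_trans (ler_norm _)) // normrM rs.
    by rewrite (le_trans _ sM) // ler_wpM2l // ltW.
  have := cumulantD p_ge0 p_sum t h_le.
  under eq_bigr do rewrite dx.
  have : \sum_i q i * (r * x i 0 j) ^+ 2 <= s ^+ 2 * M ^+ 2.
    rewrite -[leRHS]mul1r -q_sum mulr_suml ler_sum // => i _.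
    rewrite ler_wpM2l // exprMn r2 ler_wpM2l ?sqr_ge0 //.
    by rewrite -real_normK ?num_real // lerXn2r ?nnegrE //; lra.
  rewrite -/q; set V := \sum_i _; move=> V_le cum_le.
  rewrite dotpDl dotpZl dotp_delta [dotp (t + _) (t + _)]dotpDl.
  rewrite !(dotpC _ (t + _)) !dotpDl !dotpZl !dotp_delta.
  rewrite !(dotpC t (_ *: _)) !dotpZl !dotp_delta !mxE !eqxx mulr1.
  move: cum_le; rewrite dotpZl dotp_delta -/mu /g /C => cum_le phi_le'.
  have : r * r = s ^+ 2 by rewrite -expr2.
  have : eps / 2 * s ^+ 2 <= s ^+ 2 by nra.
  move: V_le cum_le phi_le'; set c1 := cumulant _ _ _; set c2 := cumulant _ _ _.
  move=> V_le cum_le phi_le' h1 h2.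
  have h3 : eps / 2 * (r * r) <= s ^+ 2 by rewrite h2.
  nra.
have g_bnd j : `|g j| <= s * C.
  rewrite ler_norml -(ler_pM2l s0) -[X in _ && X](ler_pM2l s0) mulrN mulrA -expr2.
  rewrite g_le // andbT lerNl -mulNr g_le // sqrrN //.
split=> [j|].
  have -> : z 0 j - mu 0 j = g j + eps * t 0 j by rewrite /g; ring.
  apply: (le_lt_trans (ler_normD _ _)).
  have : `|eps * t 0 j| <= delta / 2.
    rewrite -sqrtr_sqr -[leRHS]gtr0_norm ?divr_gt0 // -sqrtr_sqr ler_wsqrtr //.
    have := dotp_coord t j; rewrite exprMn; nra.
  have := g_bnd j; lra.
(* Since the Legendre functional at [z] is at most [v], it remains to bound this sum below by more
   than [- delta]. *)
have t_diff : \sum_j t 0 j * (z 0 j - mu 0 j) = dotp t z - dotp t mu.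
  by rewrite -sumrB; apply: eq_bigr => j _; rewrite mulrBr.
have : - (d%:R * (s * C) ^+ 2 / (4 * eps)) <= \sum_j t 0 j * (z 0 j - mu 0 j).
  rewrite -mulrA -[d in d%:R]card_ord mulr_natl -sumr_const -sumrN ler_sum // => j _.
  have -> : z 0 j - mu 0 j = g j + eps * t 0 j by rewrite /g; ring.
  rewrite lerNl ler_pdivlMr ?mulr_gt0 //.
  have : g j ^+ 2 <= (s * C) ^+ 2.
    by rewrite -real_normK ?num_real // lerXn2r ?nnegrE //;
      have := normr_ge0 (g j); have := g_bnd j; lra.
  (* completing the square: [eps t^2 + t g >= - g^2 / (4 eps)] *)
  have := sqr_ge0 (2 * eps * t 0 j + g j).
  nra.
have : d%:R * (s * C) ^+ 2 / (4 * eps) < delta.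
  rewrite ltr_pdivrMr ?mulr_gt0 //.
  have : (d%:R : R) <= D by rewrite ler_nat.
  have : (0 : R) <= d%:R by [].
  move=> h1 h2.
  have h3 : d%:R * (s * C) ^+ 2 <= s * (s * (C ^+ 2 * D)).
    rewrite exprMn; have : 0 <= s ^+ 2 * C ^+ 2 by rewrite mulr_ge0 ?sqr_ge0.
    nra.
  have de0 : 0 < delta * eps by rewrite mulr_gt0.
  have : s * (s * (C ^+ 2 * D)) <= 2^-1 * (delta * eps).
    by rewrite ler_pM // ltW // mulr_gt0.
  lra.
have := z_le t; rewrite t_diff; lra.
Qed.

End LowerBound.

Section CramerLowerBound.
Variables (R : realType) (m d : nat).
Variables (p : 'I_m -> R) (x : 'I_m -> 'rV[R]_d).
Hypothesis p_ge0 : forall i, 0 <= p i.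
Hypothesis p_sum : \sum_i p i = 1.

(** Union bound over [2 d] scalar weak laws, one for each coordinate and each sign, the boolean
    encoding the sign. *)
Lemma weak_law_vec (q : 'I_m -> R) (delta eps : R) : (forall i, 0 <= q i) ->
  \sum_i q i = 1 -> 0 < delta -> 0 < eps ->
  \forall n \near \oo, 1 - eps <= wprob q [set w : {ffun 'I_n -> 'I_m} |
    forall j, `|\sum_(k < n) x (w k) 0 j - n%:R * mean q x 0 j| < n%:R * delta].
Proof.
move=> q0 q1 d0 eps0.
pose y (jb : 'I_d * bool) i := (-1) ^+ jb.2 * (x i 0 jb.1 - mean q x 0 jb.1).
have qy jb : \sum_i q i * y jb i = 0.
  under eq_bigr do rewrite mulrCA.
  rewrite -mulr_sumr; under eq_bigr do rewrite mulrBr.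
  by rewrite sumrB -mulr_suml q1 mul1r meanE subrr mulr0.
pose D : R := (#|{: 'I_d * bool}|).+1%:R.
have D0 : 0 < D by rewrite ltr0n.
have epsD : 0 < eps / D by rewrite divr_gt0.
have : \forall n \near \oo, forall jb, wprob q
    [set w : {ffun 'I_n -> 'I_m} | n%:R * delta <= \sum_(k < n) y jb (w k)]
    <= eps / D.
  by apply: filter_forall => jb; apply: weak_law.
apply: filterS => n le_eps; rewrite wprobC // lerD2l lerN2.
apply: (le_trans (@wprob_bigcup _ _ q n _ (index_enum {: 'I_d * bool}) _
  (fun jb => [set w | n%:R * delta <= \sum_(k < n) y jb (w k)]) q0 _)).
  move=> w /existsNP [j /negP]; rewrite -leNgt ler_normr => le_w.
  have sum_y b : \sum_(k < n) y (j, b) (w k) =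
      (-1) ^+ b * (\sum_(k < n) x (w k) 0 j - n%:R * mean q x 0 j).
    by rewrite -mulr_sumr sumrB sumr_const card_ord mulr_natl.
  apply/hasP; case/orP: le_w => le_w; [exists (j, false) | exists (j, true)];
    rewrite ?mem_index_enum //; apply/mem_set.
    by rewrite /= sum_y expr0 mul1r.
  by rewrite /= sum_y expr1 mulN1r.
apply: (@le_trans _ _ (\sum_(jb : 'I_d * bool) eps / D)).
  by apply: ler_sum => jb _; apply: le_eps.
rewrite sumr_const -mulr_natl mulrA ler_pdivrMr // mulrC ler_wpM2l ?ltW //.
by rewrite ltr_nat.
Qed.

(** Change of measure: the mass of a word under [p] is its tilted mass times [expR] of
    [n cumulant - t . sum], where the sum is controlled by [c] on [A]. *)
Lemma tilt_lower_bound t n (A : set {ffun 'I_n -> 'I_m}) (c : R) :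
  (forall w, A w -> \sum_(k < n) dotp t (x (w k)) <= c) ->
  expR (n%:R * cumulant p x t - c) * wprob (tilt p x t) A <= wprob p A.
Proof.
move=> A_le; rewrite /wprob mulr_sumr ler_sum // => w /set_mem /A_le le_c.
rewrite /tilt big_split /= mulrCA -[leRHS]mulr1 ler_wpM2l //; first exact: prodr_ge0.
rewrite -expR_sum -expRD -[leRHS]expR0 ler_expR sumrB sumr_const card_ord.
by rewrite -mulr_natl; lra.
Qed.

(** Under the tilted law given by [exists_tilt] the event has probability at least 1/2 eventually,
    and returning to [p] costs the exponential factor. *)
Lemma cramer_lower (z : 'rV[R]_d) (v delta : R) :
  (forall t, dotp t z - cumulant p x t <= v) -> 0 < delta ->
  \forall n \near \oo, expR (- n%:R * (v + delta)) <=
    wprob p [set w : {ffun 'I_n -> 'I_m} |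
      forall j, `|\sum_(k < n) x (w k) 0 j - n%:R * z 0 j| < n%:R * delta].
Proof.
move=> z_le d0.
have d40 : 0 < delta / 4 by rewrite divr_gt0.
have [t [mu_z mu_le]] := exists_tilt p_ge0 p_sum z_le d40.
set q := tilt p x t in mu_z mu_le; set mu := mean q x in mu_z mu_le.
(* A deviation [e] per coordinate must be at most [delta / 4] and must move [t . mean] by at most
   [delta / 4]; [e = delta / (4 L)] does both. *)
pose L := 1 + \sum_j `|t 0 j|.
have L1 : 1 <= L by rewrite lerDl sumr_ge0.
pose e := delta / 4 / L.
have e0 : 0 < e by rewrite divr_gt0 //; lra.
have eL : e * L = delta / 4 by rewrite /e divfK //; lra.
have half0 : 0 < 2^-1 :> R by rewrite invr_gt0.
have := weak_law_vec (tilt_ge0 x p_ge0 t) (tilt_sum x p_ge0 p_sum t) e0 half0.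
apply: filterS2 (nbhs_infty_ger (2 / delta)) => n n_ge.
rewrite -/q -/mu; set A := [set w | _] => A_ge.
have {}n_ge : 2 <= n%:R * delta by rewrite -ler_pdivrMr.
have n0 : 0 <= n%:R :> R by [].
apply: (@le_trans _ _ (wprob p A)); last first.
  apply: le_wprob => // w A_w j; 
    have -> : \sum_(k < n) x (w k) 0 j - n%:R * z 0 j =
        (\sum_(k < n) x (w k) 0 j - n%:R * mu 0 j) - n%:R * (z 0 j - mu 0 j).
      by ring.
    apply: (le_lt_trans (ler_normB _ _)).
    rewrite normrM (ger0_norm n0).
    have := A_w j; have := mu_z j; have : e <= delta / 4 by rewrite -eL ler_peMr // ltW.
    nra.
apply: (le_trans _ (@tilt_lower_bound t n A (n%:R * (dotp t mu + delta / 4)) _)).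
  apply: (@le_trans _ _ (expR (n%:R * cumulant p x t -
      n%:R * (dotp t mu + delta / 4)) * 2^-1)); last first.
    by rewrite ler_wpM2l ?expR_ge0 //; lra.
  rewrite ler_pdivlMr // -mulrC.
  (* Half of the margin [delta] in the exponent absorbs the factor 1/2; this is why [n >= 2 / delta]
     was imposed. *)
  have two_le : 2 <= expR (n%:R * delta / 2).
    by apply: le_trans (expR_ge1Dx _); lra.
  apply: (@le_trans _ _ (expR (n%:R * delta / 2) * expR (- n%:R * (v + delta)))).
    by rewrite ler_wpM2r ?expR_ge0.
  rewrite -expRD ler_expR; nra.
move=> w A_w.
have -> : \sum_(k < n) dotp t (x (w k)) = n%:R * dotp t mu +
    \sum_j t 0 j * (\sum_(k < n) x (w k) 0 j - n%:R * mu 0 j).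
  rewrite exchange_big /= /dotp mulr_sumr -big_split /=; apply: eq_bigr => j _.
  by rewrite -mulr_sumr; ring.
rewrite mulrDr lerD2l -eL.
have -> : n%:R * (e * L) = n%:R * e + \sum_j n%:R * e * `|t 0 j|.
  by rewrite -mulr_sumr /L; ring.
rewrite -[leLHS]add0r lerD //; first by rewrite mulr_ge0 // ltW.
apply: ler_sum => j _; apply: (le_trans (ler_norm _)).
by rewrite normrM [leRHS]mulrC ler_wpM2l // ltW ?A_w.
Qed.

End CramerLowerBound.

(** * Legendre transform and the upper bound *)

(** For [f = Lambda p T] this is [rate p T]. The facts on open and compact sets only use that it is
    a supremum of continuous affine functions. *)
Definition legendre (R : realType) (d : nat) (f : 'rV[R]_d -> R)
    (z : 'rV[R]_d) : \bar R :=
  ereal_sup [set (dotp t z - f t)%:E | t in [set: 'rV[R]_d]].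

Section Legendre.
Variables (R : realType) (d : nat) (f : 'rV[R]_d -> R).

Lemma legendre_leP z (a : R) :
  (legendre f z <= a%:E)%E <-> forall t, dotp t z - f t <= a.
Proof.
split=> [le_a t|le_a]; last by apply: ge_ereal_sup => _ [t _ <-]; rewrite lee_fin.
by rewrite -lee_fin (le_trans _ le_a) // ereal_sup_ubound //; exists t.
Qed.

Lemma lt_legendreP z (a : R) :
  (a%:E < legendre f z)%E <-> exists t, a < dotp t z - f t.
Proof.
split=> [/ereal_sup_gt [_ [t _ <-]]|[t lt_a]]; first by rewrite lte_fin; exists t.
by rewrite ltNge; apply/negP => /legendre_leP /(_ t); rewrite leNgt lt_a.
Qed.

Lemma continuous_dotp (t : 'rV[R]_d) : continuous (dotp t : 'rV[R]_d -> R).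
Proof.
apply: continuous_big => [|j _ z]; first exact: add_continuous.
apply: (@cvgM _ _ (nbhs z) _ (fun=> t 0 j) (fun y => y 0 j)).
  exact: cvg_cst.
exact: (@coord_continuous R 1 d 0 j).
Qed.

Lemma open_dotp_gt t (a : R) : open [set z : 'rV[R]_d | a < dotp t z - f t].
Proof.
have -> : [set z | a < dotp t z - f t] = dotp t @^-1` [set y | a + f t < y].
  by apply/seteqP; split=> z /=; rewrite ltrBrDr.
by apply: open_comp => [z _|]; [exact: continuous_dotp | exact: open_gt].
Qed.

(** Lower semicontinuity: the set is a union of open half-spaces, one for each slope [t]. *)
Lemma open_legendre_gt (a : R) : open [set z | (a%:E < legendre f z)%E].
Proof.
have -> : [set z | (a%:E < legendre f z)%E] =
    \bigcup_t [set z : 'rV[R]_d | a < dotp t z - f t].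
  apply/seteqP; split=> z /=.
    by move=> /lt_legendreP [t ?]; exists t.
  by move=> [t _ ?]; apply/lt_legendreP; exists t.
by apply: bigcup_open => t _; exact: open_dotp_gt.
Qed.

Lemma compact_box (M : R) : compact [set z : 'rV[R]_d | forall j, `|z 0 j| <= M].
Proof.
have -> : [set z : 'rV[R]_d | forall j, `|z 0 j| <= M] =
    [set z : 'rV[R]_d | forall j, `[- M, M]%classic (z ord0 j)].
  apply/seteqP; split=> z /= le_M j; have := le_M j; rewrite /= in_itv /= ler_norml //.
by apply: (@rV_compact R d (fun=> `[- M, M]%classic)) => j; exact: segment_compact.
Qed.

Lemma compact_legendre_cover (K : set 'rV[R]_d) (a : R) : compact K ->
  (forall z, K z -> (a%:E < legendre f z)%E) ->
  exists s : seq 'rV[R]_d, forall z, K z -> has (fun t => a < dotp t z - f t) s.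
Proof.
rewrite compact_cover => K_cpt K_gt.
have [|z Kz|s _ s_cov] := K_cpt _ setT (fun t => [set z | a < dotp t z - f t]).
- by move=> t _; exact: open_dotp_gt.
- by have /lt_legendreP [t ?] := K_gt z Kz; exists t.
exists (finmap.enum_fset s) => z /s_cov [t /= ts lt_a]; by apply/hasP; exists t.
Qed.

(** The open sets where the transform exceeds [a + 1/(n+1)] cover [K]; the largest index in a finite
    subcover gives [b]. *)
Lemma compact_legendre_min (K : set 'rV[R]_d) (a : R) : compact K ->
  (forall z, K z -> (a%:E < legendre f z)%E) ->
  exists2 b, a < b & forall z, K z -> (b%:E <= legendre f z)%E.
Proof.
rewrite compact_cover => K_cpt K_gt.
have [|z Kz|s _ s_cov] := K_cpt _ setT
    (fun n => [set z | ((a + n.+1%:R^-1)%:E < legendre f z)%E]).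
- by move=> n _; exact: open_legendre_gt.
- have /lt_legendreP [t /ltr_add_invr [n lt_n]] := K_gt z Kz.
  by exists n => //; apply/lt_legendreP; exists t.
exists (a + (\max_(n <- finmap.enum_fset s) n).+1%:R^-1); first by rewrite ltrDl invr_gt0.
move=> z /s_cov [n /= ns /ltW]; apply: le_trans.
by rewrite lee_fin lerD2l lef_pV2 ?posrE // ler_nat ltnS leq_bigmax_seq.
Qed.

End Legendre.

Section CumulantLegendre.
Variables (R : realType) (m d : nat).
Variables (p : 'I_m -> R) (x : 'I_m -> 'rV[R]_d).
Hypothesis p_ge0 : forall i, 0 <= p i.
Hypothesis p_sum : \sum_i p i = 1.
Local Notation I := (legendre (cumulant p x)).

Lemma legendre_cumulant_ge0 z : (0 <= I z)%E.
Proof.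
by apply: ereal_sup_ubound; exists 0 => //; rewrite dotp0l cumulant0 // subrr.
Qed.

Lemma cumulant_le t (c : R) : (forall i, dotp t (x i) <= c) -> cumulant p x t <= c.
Proof.
move=> le_c; rewrite -ler_expR expR_cumulant // -[leRHS]mul1r -p_sum mulr_suml.
by apply: ler_sum => i _; rewrite ler_wpM2l // ler_expR.
Qed.

(** If [|z_j| > M], the slope [s sg(z_j) e_j] gives at least [s (|z_j| - M)], which equals [a + 1]
    for the chosen [s]. *)
Lemma legendre_cumulant_box (M a : R) z : (forall i j, `|x i 0 j| <= M) ->
  (I z <= a%:E)%E -> forall j, `|z 0 j| <= M.
Proof.
move=> xM /legendre_leP z_le j; rewrite leNgt; apply/negP => M_lt.
have a0 : 0 <= a by have := z_le 0; rewrite dotp0l cumulant0 // subrr.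
pose s := (a + 1) / (`|z 0 j| - M).
have s0 : 0 < s by rewrite divr_gt0 ?subr_gt0 //; lra.
pose t : 'rV[R]_d := (s * Num.sg (z 0 j)) *: delta_mx 0 j.
have tx i : dotp t (x i) <= s * M.
  rewrite dotpZl dotp_delta -mulrA ler_wpM2l ?(ltW s0) //.
  apply: (le_trans (ler_norm _)); rewrite normrM (le_trans _ (xM i j)) //.
  by rewrite ler_piMl // normr_sg; case: eqP.
have := le_trans (lerB (lexx _) (cumulant_le tx)) (z_le t).
rewrite dotpZl dotp_delta -mulrA -normrEsg -mulrBr /s divfK ?subr_eq0 ?gt_eqF //.
by lra.
Qed.

Lemma compact_sublevel (a : R) : compact [set z | (I z <= a%:E)%E].
Proof.
have [M _ xM] := exists_coord_bound x.
apply: (subclosed_compact _ (@compact_box R d M)).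
  rewrite -[X in closed X]setCK closedC.
  rewrite (_ : ~` _ = [set z | (a%:E < I z)%E]); first exact: open_legendre_gt.
  by apply/seteqP; split=> z /=; rewrite ltNge => /negP.
by move=> z /= /legendre_cumulant_box; apply.
Qed.

(** [N] counts the half-spaces covering [K]. Chernoff's bound with slope [t] at level
    [a + cumulant p x t] has base exactly [expR (- a)]. *)
Lemma cramer_upper (K : set 'rV[R]_d) (a : R) : compact K ->
  (forall z, K z -> (a%:E < I z)%E) ->
  exists N : nat, forall n, (0 < n)%N ->
    wprob p [set w : {ffun 'I_n -> 'I_m} |
      K (n%:R^-1 *: \sum_(k < n) x (w k))] <= N%:R * expR (- n%:R * a).
Proof.
move=> K_cpt K_gt; have [s s_cov] := compact_legendre_cover K_cpt K_gt.
exists (size s) => n n0; have nR0 : (0 : R) < n%:R by rewrite ltr0n.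
pose F t := [set w : {ffun 'I_n -> 'I_m} |
  n%:R * (a + cumulant p x t) <= \sum_(k < n) dotp t (x (w k))].
apply: (le_trans (@wprob_bigcup _ _ p n _ s _ F p_ge0 _)) => [w /= /s_cov|].
  apply: sub_has => t /ltW; rewrite dotpC dotpZl dotpC => le_t.
  apply/mem_set; rewrite /F /=.
  have -> : \sum_(k < n) dotp t (x (w k)) = dotp t (\sum_(k < n) x (w k)).
    rewrite /dotp exchange_big; apply: eq_bigr => j _.
    by rewrite summxE mulr_sumr.
  by rewrite mulrC -ler_pdivlMr // -lerBrDr mulrC.
have -> : (size s)%:R * expR (- n%:R * a) = \sum_(t <- s) expR (- n%:R * a).
  by rewrite big_const_seq count_predT iter_addr_0 mulr_natl.
apply: ler_sum => t _; apply: (le_trans 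
  (chernoff (fun i => dotp t (x i)) (a + cumulant p x t) n p_ge0)).
rewrite (_ : \sum_i _ = expR (- a)); first by rewrite -expRM_natl mulrN mulNr.
rewrite (eq_bigr (fun i => p i * expR (dotp t (x i)) *
    expR (- (a + cumulant p x t)))) => [|i _]; last by rewrite expRD mulrA.
rewrite -mulr_suml -expR_cumulant // -expRD; congr expR; ring.
Qed.

End CumulantLegendre.

(** * Spectral radii of products of triangular matrices *)

Section Triangular.

Lemma mulmx_trig (V : comNzRingType) (n : nat) (A B : 'M[V]_n) :
  is_trig_mx A -> is_trig_mx B ->
  is_trig_mx (A *m B) /\ forall i, (A *m B) i i = A i i * B i i.
Proof.
move=> /is_trig_mxP trA /is_trig_mxP trB; split=> [|i].
  apply/is_trig_mxP => i j lt_ij; rewrite mxE big1 // => k _.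
  case: (ltnP i k) => [lt_ik|le_ki]; first by rewrite trA // mul0r.
  by rewrite trB ?mulr0 // (leq_ltn_trans le_ki).
rewrite mxE (bigD1 i) //= big1 ?addr0 // => k; rewrite neq_ltn => /orP[lt_ki|lt_ik].
  by rewrite trB ?mulr0.
by rewrite trA ?mul0r.
Qed.

Lemma char_poly_trmx (V : comNzRingType) (n : nat) (A : 'M[V]_n) :
  char_poly A^T = char_poly A.
Proof.
rewrite /char_poly -[RHS]det_tr; congr (\det _).
by rewrite /char_poly_mx linearB /= tr_scalar_mx map_trmx.
Qed.

(** [is_trig_mx] means lower triangular, so the first alternative is the upper triangular case;
    transposition preserves the characteristic polynomial and the diagonal. *)
Lemma eigenvalue_trig (F : fieldType) (n : nat) (A : 'M[F]_n) a :
  is_trig_mx A^T \/ is_trig_mx A ->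
  eigenvalue A a <-> exists j, a = A j j.
Proof.
move=> trA; rewrite eigenvalue_root_char.
have -> : char_poly A = \prod_j ('X - (A j j)%:P).
  case: trA => [trA|]; last exact: char_poly_trig.
  rewrite -char_poly_trmx char_poly_trig //.
  by apply: eq_bigr => j _; rewrite mxE.
rewrite -(big_map (fun j => A j j) xpredT (fun u => 'X - u%:P)) root_prod_XsubC.
split=> [/mapP[j _ ->]|[j ->]]; first by exists j.
by apply/mapP; exists j; rewrite ?mem_index_enum.
Qed.

End Triangular.

(** * The largest coordinate of a vector *)

Section CoordinateMaximum.
Variables (R : realType) (d : nat).
Implicit Types z : 'rV[R]_d.+1.

(** The default value is itself a coordinate, so it does not alter the maximum; this is what the
    dimension [d.+1] is for. *)
Definition vmax z : R := \big[Num.max/z 0 ord0]_j z 0 j.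

Lemma le_vmax z j : z 0 j <= vmax z.
Proof. exact: le_bigmax. Qed.

Lemma vmax_attained z : exists j, vmax z = z 0 j.
Proof.
rewrite /vmax; elim/big_ind: _ => [|a b [i ->] [j ->]|j _].
- by exists ord0.
- by case: (leP (z 0 i) (z 0 j)) => _; [exists j | exists i].
- by exists j.
Qed.

Lemma bigmaxe_vmax z : \big[maxe/-oo%E]_(j < d.+1) (z 0 j)%:E = (vmax z)%:E.
Proof.
apply/eqP; rewrite eq_le; apply/andP; split.
  by apply: bigmax_le => [|j _]; rewrite ?leNye // lee_fin le_vmax.
by have [j ->] := vmax_attained z; apply: (le_bigmax _ (fun j => (z 0 j)%:E)).
Qed.

Lemma vmax_lipschitz z z' (e : R) :
  (forall j, `|z' 0 j - z 0 j| < e) -> `|vmax z' - vmax z| < e.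
Proof.
move=> lt_e; have [j zj] := vmax_attained z; have [j' zj'] := vmax_attained z'.
have := lt_e j; have := lt_e j'; have := le_vmax z j'; have := le_vmax z' j.
rewrite zj zj' !ltr_norml => h1 h2 /andP[h3 h4] /andP[h5 h6].
by apply/andP; split; lra.
Qed.

Lemma continuous_vmax : continuous (vmax : 'rV[R]_d.+1 -> R).
Proof.
move=> z; apply/(@cvgrPdist_lt _ _ _ (nbhs z) (nbhs_filter z)) => e e0.
have : nbhs z [set z' : 'rV[R]_d.+1 | forall j, `|z' 0 j - z 0 j| < e].
  apply: (@filter_forall _ _ _ (nbhs z) (nbhs_filter z)) => j.
  have /cvgrPdist_lt/(_ e e0) := @coord_continuous R 1 d.+1 0 j z.
  by apply: (@filterS _ (nbhs z) (nbhs_filter z)) => z'; rewrite distrC.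
by apply: (@filterS _ (nbhs z) (nbhs_filter z)) => z' /vmax_lipschitz; rewrite distrC.
Qed.

End CoordinateMaximum.

Arguments vmax {R d} z.

Section SpectralRadius.
Variables (R : realType) (m d : nat) (T : 'I_m -> 'M[R[i]]_d).
Hypothesis T_trig :
  (forall i, is_trig_mx (T i)^T) \/ (forall i, is_trig_mx (T i)).

Lemma matprod_trig (w : nat -> 'I_m) n :
  (is_trig_mx (matprod T w n)^T \/ is_trig_mx (matprod T w n)) /\
  forall j, matprod T w n j j = \prod_(k < n) T (w k) j j.
Proof.
case: T_trig => trT.
  suff [trP dgP] : is_trig_mx (matprod T w n)^T /\
      forall j, matprod T w n j j = \prod_(k < n) T (w k) j j by split; [left|].
  elim: n => [|n [trP dgP]] /=.
    rewrite trmx1 scalar_mx_is_trig; split=> // j.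
    by rewrite big_ord0 mxE eqxx.
  have [trPT dgPT] := mulmx_trig trP (trT (w n)).
  rewrite trmx_mul; split=> // j; rewrite big_ord_recr /= -dgP.
  by have := dgPT j; rewrite -trmx_mul !mxE.
suff [trP dgP] : is_trig_mx (matprod T w n) /\
    forall j, matprod T w n j j = \prod_(k < n) T (w k) j j by split; [right|].
elim: n => [|n [trP dgP]] /=.
  by rewrite scalar_mx_is_trig; split=> // j; rewrite big_ord0 mxE eqxx.
have [trPT dgPT] := mulmx_trig (trT (w n)) trP.
by split=> // j; rewrite dgPT big_ord_recr /= -dgP mulrC.
Qed.

End SpectralRadius.

Definition log_moduli (R : realType) (m d : nat) (T : 'I_m -> 'M[R[i]]_d)
    (i : 'I_m) : 'rV[R]_d := \row_j ln (cmod (T i j j)).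

Lemma LambdaE (R : realType) (m d : nat) (p : 'I_m -> R)
    (T : 'I_m -> 'M[R[i]]_d) t :
  Lambda p T t = cumulant p (log_moduli T) t.
Proof.
congr ln; apply: eq_bigr => i _; congr (_ * expR _).
by apply: eq_bigr => j _; rewrite mxE.
Qed.

Lemma cmod_gt0 (R : realType) (z : R[i]) : z != 0 -> 0 < cmod z.
Proof.
move=> z0; rewrite lt_neqAle; apply/andP; split.
  by rewrite eq_sym; apply: contra_neq z0 => /ComplexField.Normc.eq0_normc.
by case: z {z0} => a b; rewrite sqrtr_ge0.
Qed.

Lemma cmod_prod (R : realType) (n : nat) (F : 'I_n -> R[i]) :
  cmod (\prod_(k < n) F k) = \prod_(k < n) cmod (F k).
Proof.
apply: (big_morph _ (@ComplexField.Normc.normcM R)).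
exact: ComplexField.Normc.normc1.
Qed.

(** With [z] the empirical mean, the eigenvalues of the product have moduli [expR (n z_j)]; the
    largest is [expR (n vmax z)], whose [n]-th root is taken. *)
Lemma rho_nE (R : realType) (m d : nat) (T : 'I_m -> 'M[R[i]]_d.+1)
    (w : nat -> 'I_m) n :
  (forall i, is_trig_mx (T i)^T) \/ (forall i, is_trig_mx (T i)) ->
  (forall i j, T i j j != 0) -> (0 < n)%N ->
  rho_n T w n = expR (vmax (n%:R^-1 *: \sum_(k < n) log_moduli T (w k))).
Proof.
move=> T_trig T_diag n0; have [trP dgP] := matprod_trig T_trig w n.
have nR0 : (n%:R : R) != 0 by rewrite pnatr_eq0 -lt0n.
set z := _ *: _.
have cmodP j : cmod (matprod T w n j j) = expR (n%:R * z 0 j).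
  rewrite dgP cmod_prod /z mxE mulVKf // summxE expR_sum.
  by apply: eq_bigr => k _; rewrite mxE lnK // posrE cmod_gt0.
have srE : spectral_radius (matprod T w n) = expR (n%:R * vmax z).
  have [j zj] := vmax_attained z.
  have memS : [set cmod a | a in [set a | eigenvalue (matprod T w n) a]]
      (expR (n%:R * vmax z)).
    exists (matprod T w n j j); last by rewrite cmodP zj.
    by apply/eigenvalue_trig => //; exists j.
  have ubS : ubound [set cmod a | a in [set a | eigenvalue (matprod T w n) a]]
      (expR (n%:R * vmax z)).
    move=> _ [a /= /eigenvalue_trig [//|j' ->] <-].
    by rewrite cmodP ler_expR ler_wpM2l // le_vmax.
  apply/eqP; rewrite eq_le; apply/andP; split.
    by apply: ge_sup => //; exists (expR (n%:R * vmax z)).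
  by apply: ub_le_sup => //; exists (expR (n%:R * vmax z)).
by rewrite /rho_n srE /powR gt_eqF ?expR_gt0 // expRK mulKf.
Qed.

(** The event is a finite disjoint union of cylinders, one per word, and independence evaluates each
    cylinder. *)
Lemma iid_wprob (disp : measure_display) (Omega : measurableType disp)
    (R : realType) (P : probability Omega R) (m : nat) (p : 'I_m -> R)
    (idx : nat -> Omega -> 'I_m) (n : nat) (A : set {ffun 'I_n -> 'I_m}) :
  iid_indices P p idx ->
  P [set omega | A [ffun k : 'I_n => idx k omega]] = (wprob p A)%:E.
Proof.
move=> [idx_meas idx_indep idx_law].
(* Independence is phrased for families indexed by all of [nat]; for [k >= n] the condition is
   vacuous and the set is full. *)
pose C (w : {ffun 'I_n -> 'I_m}) (k : nat) : set 'I_m :=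
  [set i | forall lt_kn : (k < n)%N, w (Ordinal lt_kn) = i].
pose E w := \bigcap_(k in [set` iota 0 n]) (idx k @^-1` C w k).
have E_eq w : E w = [set omega | [ffun k : 'I_n => idx k omega] = w].
  apply/seteqP; split=> omega.
    move=> Ew; apply/ffunP => k; rewrite ffunE.
    by have := Ew k; rewrite /= mem_iota /= => /(_ (ltn_ord k)) <-; congr (w _); exact: val_inj.
  move=> <- k _ lt_kn; by rewrite ffunE.
have E_meas w : measurable (E w).
  by apply: fin_bigcap_measurable => // k _; exact: idx_meas.
have PE w : P (E w) = (\prod_(k < n) p (w k))%:E.
  rewrite idx_indep ?iota_uniq // -prodEFin.
  rewrite -[X in iota 0 X]subn0 -/(index_iota 0 n).
  rewrite big_mkord; apply: eq_bigr => k _; rewrite -(idx_law k (w k)); congr (P (_ @^-1` _)).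
  apply/seteqP; split=> i /=.
    by move=> /(_ (ltn_ord k)) <-; congr (w _); exact: val_inj.
  move=> -> lt_kn; congr (w _); exact: val_inj.
have -> : [set omega | A [ffun k : 'I_n => idx k omega]] = \bigcup_(w in A) E w.
  apply/seteqP; split=> omega /=.
    by move=> Aw; exists [ffun k : 'I_n => idx k omega]; rewrite ?E_eq.
  by move=> [w Aw]; rewrite E_eq /= => ->.
have E_triv : trivIset A E.
  apply/trivIsetP => w1 w2 _ _ /eqP w12; rewrite !E_eq.
  by apply/seteqP; split=> omega //= [-> ].
rewrite (measure_fin_bigcup P finite_finset E_triv) => [|w _]; last exact: E_meas.
pose r := [seq w <- index_enum {ffun 'I_n -> 'I_m} | w \in A].
rewrite (fsbigE r) ?filter_uniq ?index_enum_uniq //; last 2 first.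
- by move=> w; rewrite /r /= mem_filter => /andP[/set_mem].
- by move=> w Aw; rewrite /r mem_filter mem_index_enum andbT => /negP[]; exact/mem_set.
rewrite /r big_filter_cond; under eq_bigl do rewrite andbb.
rewrite (eq_bigr (fun w : {ffun 'I_n -> 'I_m} => (\prod_(k < n) p (w k))%:E)).
  by rewrite sumEFin.
by move=> w _; exact: PE.
Qed.

(** * Contraction and the large deviation principle *)

Section ExtendedReals.
Variable R : realType.
Implicit Types (u : nat -> \bar R) (l c : \bar R).

Lemma near_limn_esup_le u l :
  (\forall n \near \oo, (u n <= l)%E) -> (limn_esup u <= l)%E.
Proof.
move=> u_le; apply: ge_ereal_inf.
exists (ereal_sup [set u n | n in [set n | (u n <= l)%E]]); first by exists [set n | (u n <= l)%E].
by apply: ge_ereal_sup => _ [n /= ? <-].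
Qed.

Lemma near_limn_einf_ge u l :
  (\forall n \near \oo, (l <= u n)%E) -> (l <= limn_einf u)%E.
Proof.
move=> u_ge; rewrite /limn_einf leeNr; apply: near_limn_esup_le.
by apply: filterS u_ge => n; rewrite leeN2.
Qed.

(** Real levels below [c] suffice, also when [c] is [+oo], as for the infimum over an empty
    closure. *)
Lemma le_oppe_real l c :
  (forall a : R, (a%:E < c)%E -> (l <= (- a)%:E)%E) -> (l <= - c)%E.
Proof.
case: c => [r||] le_l; last by rewrite leey.
  apply/lee_addgt0Pr => e e0; apply: le_trans (le_l (r - e) _) _.
    by rewrite lte_fin ltrBlDr ltrDl.
  by rewrite -EFinN -EFinD lee_fin opprB addrC.
case: l le_l => [r||] le_l //; last by have := le_l 0 (ltry _).
have := le_l (1 - r) (ltry _); rewrite lee_fin => r_le.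
by exfalso; lra.
Qed.

Lemma lne_rate_le (n : nat) (q a : R) : (0 < n)%N -> 0 <= q ->
  q <= expR (- n%:R * a) -> ((n%:R^-1)%:E * lne q%:E <= (- a)%:E)%E.
Proof.
move=> n0 q0 q_le; have nR0 : (0 : R) < n%:R by rewrite ltr0n.
move: q0; rewrite le_eqVlt => /predU1P[<-|q0].
  by rewrite le0_lneNy // gt0_muleNy ?leNye // lte_fin invr_gt0.
rewrite lne_EFin // -EFinM lee_fin mulrC ler_pdivrMr // mulNr mulrC -mulNr.
by rewrite -ler_expR lnK.
Qed.

Lemma lne_rate_ge (n : nat) (q a : R) : (0 < n)%N ->
  expR (- n%:R * a) <= q -> ((- a)%:E <= (n%:R^-1)%:E * lne q%:E)%E.
Proof.
move=> n0 q_ge; have nR0 : (0 : R) < n%:R by rewrite ltr0n.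
have q0 : 0 < q by apply: lt_le_trans q_ge; exact: expR_gt0.
rewrite lne_EFin // -EFinM lee_fin mulrC ler_pdivlMr // mulNr mulrC -mulNr.
by rewrite -ler_expR lnK.
Qed.

End ExtendedReals.

Section Contraction.
Variables (R : realType) (m d : nat) (p : 'I_m -> R).
Variable T : 'I_m -> 'M[R[i]]_d.+1.
Hypothesis p_ge0 : forall i, 0 <= p i.
Hypothesis p_sum : \sum_i p i = 1.
Local Notation x := (log_moduli T).
Local Notation I := (legendre (cumulant p x)).
Local Notation J := (contracted_rate p T).

Lemma contracted_rateE r :
  J r = ereal_inf [set I z | z in [set z | vmax z = ln r]].
Proof.
rewrite /contracted_rate /rate.
have -> : Lambda p T = cumulant p x by apply/funext => t; exact: LambdaE.
congr (ereal_inf [set _ | z in _]); apply/seteqP; split=> z /=;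
  rewrite bigmaxe_vmax; by [case | move=> ->].
Qed.

Lemma closed_vmax_eq (y : R) : closed [set z : 'rV[R]_d.+1 | vmax z = y].
Proof.
have -> : [set z : 'rV[R]_d.+1 | vmax z = y] = vmax @^-1` [set y] by [].
by apply: preimage_closed => [z _|]; [exact: continuous_vmax | exact: closed_eq].
Qed.

(** Otherwise [I > a] on the compact set [K], hence [I >= b > a] there, while off [K] the fibre has
    [I > a + 1]; so [J r] would exceed [a]. Cutting at [a + 1] provides compactness. *)
Lemma contracted_rate_attained r (a : R) : (J r <= a%:E)%E ->
  exists2 z, vmax z = ln r & (I z <= a%:E)%E.
Proof.
move=> J_le; apply: contrapT => no_z.
have a1 : a < a + 1 by rewrite ltrDl.
pose K := [set z | (I z <= (a + 1)%:E)%E] `&` [set z | vmax z = ln r].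
have K_cpt : compact K.
  by apply: compact_closedI; [exact: compact_sublevel | exact: closed_vmax_eq].
have [z [_ vz]|b ab b_le] := @compact_legendre_min _ _ (cumulant p x) K a K_cpt.
  by rewrite ltNge; apply/negP => Iz; apply: no_z; exists z.
have : ((Num.min b (a + 1))%:E <= J r)%E.
  rewrite contracted_rateE; apply/ereal_infP => _ [z /= vz <-].
  have [Iz|/ltW Iz] := leP (I z) (a + 1)%:E.
    by apply: le_trans (b_le z _); rewrite // lee_fin ge_min lexx.
  by apply: le_trans Iz; rewrite lee_fin ge_min lexx orbT.
move=> /le_trans/(_ J_le); rewrite lee_fin leNgt lt_min ab a1 //.
Qed.

(** Attainment of the infimum makes this an equality; it exhibits the sublevel set as a continuous
    image of a compact one. *)
Lemma contracted_sublevel (a : R) :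
  [set r | 0 < r] `&` [set r | (J r <= a%:E)%E] =
  (expR \o vmax) @` [set z | (I z <= a%:E)%E].
Proof.
apply/seteqP; split=> [r [r0 /= /contracted_rate_attained [z vz Iz]]|_ [z /= Iz <-]].
  by exists z => //=; rewrite vz lnK.
split; first exact: expR_gt0.
rewrite /= contracted_rateE; apply: ge_ereal_inf; exists (I z) => //.
by exists z => //=; rewrite expRK.
Qed.

Lemma compact_contracted_sublevel (a : R) :
  compact ([set r | 0 < r] `&` [set r | (J r <= a%:E)%E]).
Proof.
rewrite contracted_sublevel; apply: continuous_compact; last exact: compact_sublevel.
apply: continuous_subspaceT => z.
by apply: continuous_comp; [exact: continuous_vmax | exact: continuous_expR].
Qed.

Lemma nbhs_positive (r : R) : 0 < r ->
  nbhs (r : subspace [set r : R | 0 < r]) = nbhs r.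
Proof.
move=> r0; rewrite -nbhs_subspace_interior //.
by have /open_nbhs_nbhs : open_nbhs r [set r : R | 0 < r] by split; [exact: open_gt|].
Qed.

Lemma good_contracted_rate : good_rate_function [set r | 0 < r] J.
Proof.
split=> [r _|r a a_lt|a].
- rewrite contracted_rateE; apply/ereal_infP => _ [z _ <-].
  exact: legendre_cumulant_ge0.
- have [r0|r0] := boolP (0 < r); last first.
    (* Points outside the half-line are isolated in the subspace topology. *)
    exists [set r] => [|_ ->] //.
    have : globally [set r] [set r] by [].
    by rewrite (@nbhs_subspace_out R [set r : R | 0 < r] r (negP r0)).
  (* The sublevel set is compact, hence closed in [R], so its complement is a neighbourhood of
     [r]. *)
  exists ([set r | 0 < r] `&`
      ~` ([set r | 0 < r] `&` [set r | (J r <= a%:E)%E])); last first.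
    move=> y [y0 /= J_gt]; rewrite ltNge; apply/negP => J_le; exact: J_gt.
  rewrite nbhs_positive //; apply: filterI.
    by apply: open_nbhs_nbhs; split; [exact: open_gt|].
  apply: open_nbhs_nbhs; split; last by move=> [_ /=]; rewrite leNgt a_lt.
  apply: closed_openC; apply: compact_closed => //.
  exact: compact_contracted_sublevel.
- by rewrite setIC; apply/compact_subspaceIP; rewrite setIC;
    exact: compact_contracted_sublevel.
Qed.

End Contraction.

(** * Exponential bounds for events of the spectral radius *)

Section LargeDeviations.
Variables (R : realType) (m d : nat) (p : 'I_m -> R).
Variable T : 'I_m -> 'M[R[i]]_d.+1.
Hypothesis p_ge0 : forall i, 0 <= p i.
Hypothesis p_sum : \sum_i p i = 1.
Local Notation x := (log_moduli T).
Local Notation I := (legendre (cumulant p x)).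
Local Notation J := (contracted_rate p T).
Local Notation E := [set r : R | 0 < r].

Definition radius_event (B : set R) (n : nat) : set {ffun 'I_n -> 'I_m} :=
  [set w | B (expR (vmax (n%:R^-1 *: \sum_(k < n) x (w k))))].

Lemma radius_event_upper (B : set R) (a eps : R) : B `<=` E ->
  (a%:E < ereal_inf (J @` closure (B : set (subspace E))))%E -> 0 < eps ->
  \forall n \near \oo,
    wprob p (@radius_event B n) <= expR (- n%:R * (a - eps)).
Proof.
move=> BE a_lt eps0; have [M _ xM] := exists_coord_bound x.
(* All empirical means lie in the box, which makes the preimage of the closed set compact. The
   closure is taken in [R]; positivity of [expR] brings its relevant points back into [E]. *)
pose K := [set z : 'rV[R]_d.+1 | forall j, `|z 0 j| <= M] `&`
  (expR \o vmax) @^-1` closure B.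
have K_cpt : compact K.
  apply: compact_closedI; first exact: compact_box.
  apply: preimage_closed; last exact: closed_closure.
  by move=> z _; apply: continuous_comp;
    [exact: continuous_vmax | exact: continuous_expR].
have K_gt z : K z -> (a%:E < I z)%E.
  move=> [_ /= Bz]; apply: (lt_le_trans a_lt).
  apply: (@le_trans _ _ (J (expR (vmax z)))).
    apply: ereal_inf_lbound; exists (expR (vmax z)) => //.
    by rewrite closure_subspaceW //; split => //=; exact: expR_gt0.
  rewrite contracted_rateE; apply: ereal_inf_lbound.
  by exists z => //=; rewrite expRK.
have [N N_le] := cramer_upper p_ge0 p_sum K_cpt K_gt.
near=> n.
have n0 : (0 < n)%N by near: n; exact: nbhs_infty_gt.
(* The prefactor is absorbed through [N <= n eps <= expR (n eps)]. *)
have N_n : N%:R / eps <= n%:R by near: n; exact: nbhs_infty_ger.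
apply: (le_trans _ (le_trans (N_le n n0) _)).
  apply: le_wprob => // w Bw; split=> [j|]; last exact: subset_closure.
  rewrite !mxE summxE normrM ger0_norm ?invr_ge0 // mulrC ler_pdivrMr ?ltr0n //.
  apply: (le_trans (ler_norm_sum _ _ _)).
  apply: (@le_trans _ _ (\sum_(k < n) M)); first by apply: ler_sum.
  by rewrite sumr_const card_ord mulr_natr.
have -> : - n%:R * (a - eps) = n%:R * eps + - n%:R * a by ring.
rewrite expRD ler_wpM2r ?expR_ge0 //.
apply: le_trans (expR_ge1Dx _).
by move: N_n; rewrite ler_pdivrMr //; lra.
Unshelve. all: by end_near. Qed.

Lemma radius_event_lower (B : set R) (z : 'rV[R]_d.+1) (v eps : R) :
  nbhs (expR (vmax z)) B -> (I z <= v%:E)%E -> 0 < eps ->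
  \forall n \near \oo,
    expR (- n%:R * (v + eps)) <= wprob p (@radius_event B n).
Proof.
move=> nB /legendre_leP Iz eps0.
have [delta /= d0 B_delta] : exists2 delta : R, 0 < delta &
    forall y, `|y - vmax z| < delta -> B (expR y).
  have /nbhs_ballP [delta d0 B_delta] : nbhs (vmax z) (expR @^-1` B).
    exact: continuous_expR.
  by exists delta => // y ?; apply: B_delta; rewrite /ball /= distrC.
(* [cramer_lower] has one parameter for both the radius and the loss in the exponent, so [e] must be
   below both bounds. *)
pose e := Num.min delta eps.
have e0 : 0 < e by rewrite lt_min d0.
near=> n.
have n0 : (0 < n)%N by near: n; exact: nbhs_infty_gt.
have nR0 : (0 : R) < n%:R by rewrite ltr0n.
apply: (@le_trans _ _ (expR (- n%:R * (v + e)))).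
  by rewrite ler_expR !mulNr lerN2 ler_wpM2l // lerD2l ge_min lexx orbT.
apply: (@le_trans _ _ (wprob p [set w : {ffun 'I_n -> 'I_m} | forall j,
    `|\sum_(k < n) x (w k) 0 j - n%:R * z 0 j| < n%:R * e])).
  by near: n; exact: cramer_lower.
apply: le_wprob => // w w_z; apply: B_delta.
apply: (@lt_le_trans _ _ e); last by rewrite ge_min lexx.
apply: vmax_lipschitz => j; rewrite !mxE summxE.
by rewrite -(ltr_pM2l nR0) -[X in X * `|_|]ger0_norm // -normrM mulrBr mulVKf ?gt_eqF //.
Unshelve. all: by end_near. Qed.

End LargeDeviations.

Theorem theorem8 (R : realType) (m d : nat) (d_gt0 : (0 < d)%N)
    (T : 'I_m -> 'M[R[i]]_d) (p : 'I_m -> R)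
    (T_trig : (forall i, is_trig_mx (T i)^T) \/ (forall i, is_trig_mx (T i)))
    (T_diag : forall i j, T i j j != 0)
    (p_ge0 : forall i, 0 <= p i) (p_sum : \sum_(i < m) p i = 1)
    (disp : measure_display) (Omega : measurableType disp)
    (P : probability Omega R) (idx : nat -> Omega -> 'I_m)
    (idx_iid : iid_indices P p idx) :
  LDP P [set r : R | 0 < r]
    (fun n omega => rho_n T (fun k => idx k omega) n)
    (contracted_rate p T).
Proof.
(* A dimension of the form [d.+1] makes [vmax] available. *)
case: d d_gt0 T T_trig T_diag => // d _ T T_trig T_diag.
split=> [|B B_meas BE]; first exact: good_contracted_rate.
have P_B n : (0 < n)%N ->
    P ((fun omega => rho_n T (fun k => idx k omega) n) @^-1` B) =
    (wprob p (@radius_event R m d T B n))%:E.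
  move=> n0; rewrite -(iid_wprob _ idx_iid); congr (P _).
  have sumE omega :
      \sum_(k < n) log_moduli T ([ffun k : 'I_n => idx k omega] k) =
      \sum_(k < n) log_moduli T (idx k omega).
    by apply: eq_bigr => k _; rewrite ffunE.
  by apply/seteqP; split=> omega; rewrite /radius_event /= sumE rho_nE.
split; last 1 first.
- apply: le_oppe_real => a a_lt; apply/lee_addgt0Pr => eps eps0.
  apply: near_limn_esup_le; near=> n.
  have n0 : (0 < n)%N by near: n; exact: nbhs_infty_gt.
  rewrite P_B // -EFinD -[- a + eps]opprK opprD opprK.
  apply: lne_rate_le => //; first exact: wprob_ge0.
  by near: n; exact: radius_event_upper.
- rewrite leeNl; apply/ereal_infP => _ [r B_r <-].
  have r0 : 0 < r by apply: BE; exact: interior_subset B_r.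
  rewrite contracted_rateE; apply/ereal_infP => _ [z /= vz <-].
  have Iz0 := legendre_cumulant_ge0 (log_moduli T) p_sum z.
  case Iz : (legendre _ _) Iz0 => [v||] // _; last by rewrite leey.
  rewrite leeNl -EFinN; apply/lee_subgt0Pr => eps eps0.
  apply: near_limn_einf_ge; near=> n.
  have n0 : (0 < n)%N by near: n; exact: nbhs_infty_gt.
  rewrite P_B // -EFinN -EFinD -opprD.
  apply: lne_rate_ge => //.
  near: n; apply: (radius_event_lower p_ge0 p_sum (z := z)) => //; last by rewrite Iz.
  (* As [r > 0], a neighbourhood in the subspace is one in [R]. *)
  by rewrite vz lnK // -nbhs_positive.
- exact: limn_einf_sup.
Unshelve. all: by end_near. Qed.
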